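(* Let $R$ be a hyperring, $I$ a proper hyperideal of $R$, $P$ an $I$-prime hyperideal of $R$, and $J\subseteq P$ a hyperideal of $R$. Then $P/J$ is an $I$-prime hyperideal of $R/J$; that is, $P/J$ is a proper hyperideal of $R/J$ and for $\bar x,\bar y\in R/J$, $\bar x\circ\bar y\subseteq P/J-I(P/J)$ implies $\bar x\in P/J$ or $\bar y\in P/J$.
   Context: ''Hyperring'' means a commutative multiplicative hyperring with identity: $(R,+)$ is an abelian group and $\circ$ assigns to each $(a,b)\in R\times R$ a nonempty subset $a\circ b$ (also written $ab$) of $R$, with $a\circ b=b\circ a$, $a\circ(b\circ c)=(a\circ b)\circ c$, $a\circ(b+c)\subseteq a\circ b+a\circ c$, $a\circ(-b)=(-a)\circ b=-(a\circ b)$, and an element $1$ with $a\in a\circ 1$ for all $a$. For subsets, $A\circ B=\bigcup_{a\in A,b\in B}a\circ b$. A hyperideal is a nonempty $J\subseteq R$ with $a-b\in J$ and $r\circ a\subseteq J$ for $a,b\in J$, $r\in R$. For hyperideals $J,K$, $JK$ is the set of all elements lying in some finite sum $\sum_i a_i\circ b_i$ with $a_i\in J$, $b_i\in K$. The symbol $-$ between sets is set difference. A proper hyperideal $P$ is $I$-prime if for $a,b\in R$, $ab\subseteq P-IP$ implies $a\in P$ or $b\in P$. In $R/J$, $(a+J)\circ(b+J)=\{c+J: c\in a\circ b\}$. Here $I(P/J)$ denotes $(IP+J)/J$. *)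

(* Defs.v *)
From HB Require Import structures.
From mathcomp Require Import all_boot all_algebra.
From mathcomp Require Import boolp classical_sets.

Set Implicit Arguments.
Unset Strict Implicit.
Unset Printing Implicit Defensive.

Import GRing.Theory.
Local Open Scope quotient_scope.
Local Open Scope classical_set_scope.
Local Open Scope ring_scope.

Reserved Notation "a *o b" (at level 40, left associativity).
Reserved Notation "A :+: B" (at level 50, left associativity).
Reserved Notation "A :*o: B" (at level 40, left associativity).
Reserved Notation "A :/: J" (at level 40, left associativity).

Definition set_add (V : zmodType) (A B : set V) : set V :=
  [set c | exists a b, [/\ A a, B b & c = a + b]].
Notation "A :+: B" := (set_add A B) : classical_set_scope.

HB.mixin Record Zmodule_isHyperring R of GRing.Zmodule R := {
  hmul : R -> R -> set R;
  hone : R;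
  hmul_nonempty : forall a b, hmul a b !=set0;
  hmulC : forall a b, hmul a b = hmul b a;
  hmulA : forall a b c,
    \bigcup_(x in hmul b c) hmul a x = \bigcup_(x in hmul a b) hmul x c;
  hmulDr : forall a b c, hmul a (b + c) `<=` hmul a b :+: hmul a c;
  hmulrN : forall a b, hmul a (- b) = -%R @` hmul a b;
  hmulNr : forall a b, hmul (- a) b = -%R @` hmul a b;
  hmulr1 : forall a, hmul a hone a
}.

#[short(type="hyperringType")]
HB.structure Definition Hyperring := {R of Zmodule_isHyperring R & GRing.Zmodule R}.

Notation "a *o b" := (hmul a b) : ring_scope.

Definition is_hyperideal (R : hyperringType) (J : set R) : Prop :=
  [/\ J !=set0,
      forall a b, J a -> J b -> J (a - b)
    & forall r a, J a -> r *o a `<=` J].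

Record hyperideal (R : hyperringType) := Hyperideal {
  hyperideal_set :> set R;
  hyperidealP : is_hyperideal hyperideal_set
}.

(* The empty sum is harmless here: 0 lies in a *o b + (- a) *o b.             *)
Definition hyperideal_mul (R : hyperringType) (J K : set R) : set R :=
  [set x | exists (n : nat) (a b c : 'I_n -> R),
     (forall i, [/\ J (a i), K (b i) & (a i *o b i) (c i)]) /\
     x = \sum_(i < n) c i].
Notation "J :*o: K" := (hyperideal_mul J K) : classical_set_scope.

Definition I_prime (R : hyperringType) (I P : set R) : Prop :=
  [/\ is_hyperideal P, P <> setT
    & forall a b, a *o b `<=` P `\` (I :*o: P) -> P a \/ P b].

Section Quotient.
Variables (R : hyperringType) (J : hyperideal R).
Local Notation Js := (hyperideal_set J).

(* The library quotient of a zmodType takes a boolean predicate.              *)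
Definition hideal_pred : {pred R} := fun x => `[< Js x >].

Lemma hideal_predE x : (x \in hideal_pred) = `[< Js x >]. Proof. by []. Qed.

Fact hideal_zmod_closed : zmod_closed hideal_pred.
Proof.
have [[a Ja] JB _] := hyperidealP J; split=> [|x y].
  by rewrite hideal_predE; apply/asboolP; rewrite -(subrr a); exact: JB.
rewrite !hideal_predE => /asboolP Jx /asboolP Jy.
by apply/asboolP; exact: JB.
Qed.
HB.instance Definition _ :=
  GRing.isZmodClosed.Build R hideal_pred hideal_zmod_closed.

Definition hquot := Quotient.quot hideal_pred.
HB.instance Definition _ := GRing.Zmodule.on hquot.

Definition hpi (x : R) : hquot := \pi_(Quotient.quot hideal_pred) x.

Lemma hpi_surj (z : hquot) : exists x, z = hpi x.
Proof. by exists (repr z); rewrite /hpi reprK. Qed.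

Lemma hpiP x y : hpi x = hpi y <-> Js (x - y).
Proof.
rewrite /hpi; split=> [/eqP|Jxy].
  by rewrite -Quotient.idealrBE => /asboolP.
by apply/eqP; rewrite -Quotient.idealrBE; apply/asboolP.
Qed.

Lemma hpiD x y : hpi (x + y) = hpi x + hpi y.
Proof. exact: (raddfD (\pi_(Quotient.quot hideal_pred))). Qed.

Lemma hpiN x : hpi (- x) = - hpi x.
Proof. exact: (raddfN (\pi_(Quotient.quot hideal_pred))). Qed.

Definition hquot_mul (x y : hquot) : set hquot := hpi @` (repr x *o repr y).
Definition hquot_one : hquot := hpi hone.

Lemma hquot_mul_sub a b a' b' : hpi a = hpi a' -> hpi b = hpi b' ->
  hpi @` (a *o b) `<=` hpi @` (a' *o b').
Proof.
have [_ _ JM] := hyperidealP J.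
move=> /hpiP Ja /hpiP Jb _ [c abc <-].
have : (a *o (b' + (b - b'))) c by rewrite addrC subrK.
move=> /hmulDr [u [v [ab'u abv ->]]].
have Jv : Js v by exact: JM abv.
have : (b' *o (a' + (a - a'))) u by rewrite (addrC a') subrK hmulC.
move=> /hmulDr [s [t [sP tP ->]]].
have Jt : Js t by exact: JM tP.
exists s; first by rewrite hmulC.
rewrite !hpiD.
have h0 w : Js w -> hpi w = 0.
  move=> Jw; rewrite -[0](subrr (hpi 0)) -hpiN -hpiD subrr.
  by apply/hpiP; rewrite subr0.
by rewrite (h0 v Jv) (h0 t Jt) !addr0.
Qed.

(* (a + J) o (b + J) = {c + J : c in a o b}, whatever the representatives.    *)
Lemma hquot_mulE a b : hquot_mul (hpi a) (hpi b) = hpi @` (a *o b).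
Proof.
by apply/seteqP; split; apply: hquot_mul_sub; rewrite /hpi reprK.
Qed.

Fact hquot_mul_nonempty x y : hquot_mul x y !=set0.
Proof. by have [c abc] := hmul_nonempty (repr x) (repr y); exists (hpi c), c. Qed.

Fact hquot_mulC x y : hquot_mul x y = hquot_mul y x.
Proof. by rewrite /hquot_mul hmulC. Qed.

Fact hquot_mulA x y z :
  \bigcup_(t in hquot_mul y z) hquot_mul x t =
  \bigcup_(t in hquot_mul x y) hquot_mul t z.
Proof.
have [a ->] := hpi_surj x; have [b ->] := hpi_surj y.
have [c ->] := hpi_surj z; rewrite !hquot_mulE.
have /seteqP[h1 h2] := hmulA a b c.
apply/seteqP; split=> w [_ [t tP <-]]; rewrite hquot_mulE => -[u uP <-].
  have [s sP sc] : (\bigcup_(x in a *o b) x *o c) u by apply: h1; exists t.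
  by exists (hpi s); [exists s|rewrite hquot_mulE; exists u].
have [s sP sc] : (\bigcup_(x in b *o c) a *o x) u by apply: h2; exists t.
by exists (hpi s); [exists s|rewrite hquot_mulE; exists u].
Qed.

Fact hquot_mulDr x y z :
  hquot_mul x (y + z) `<=` hquot_mul x y :+: hquot_mul x z.
Proof.
have [a ->] := hpi_surj x; have [b ->] := hpi_surj y.
have [c ->] := hpi_surj z; rewrite -hpiD !hquot_mulE.
move=> _ [u /hmulDr[s [t [sP tP ->]]] <-].
exists (hpi s), (hpi t); split; [by exists s|by exists t|exact: hpiD].
Qed.

Fact hquot_mulrN x y : hquot_mul x (- y) = -%R @` hquot_mul x y.
Proof.
have [a ->] := hpi_surj x; have [b ->] := hpi_surj y.
rewrite -hpiN !hquot_mulE hmulrN !image_comp.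
by apply: eq_imagel => u _ /=; rewrite hpiN.
Qed.

Fact hquot_mulNr x y : hquot_mul (- x) y = -%R @` hquot_mul x y.
Proof. by rewrite hquot_mulC hquot_mulrN hquot_mulC. Qed.

Fact hquot_mulr1 x : hquot_mul x hquot_one x.
Proof.
have [a ->] := hpi_surj x; rewrite hquot_mulE; exists a => //; exact: hmulr1.
Qed.

HB.instance Definition _ := Zmodule_isHyperring.Build hquot
  hquot_mul_nonempty hquot_mulC hquot_mulA hquot_mulDr hquot_mulrN hquot_mulNr
  hquot_mulr1.

End Quotient.

Notation "A :/: J" := (@hpi _ J @` A) : classical_set_scope.

(* Main.v *)
Require Import Defs.
From mathcomp Require Import all_boot all_algebra.
From mathcomp Require Import boolp classical_sets.
Import GRing.Theory.
Local Open Scope classical_set_scope.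
Local Open Scope ring_scope.

(** Since [J] lies in [P], [P] is a union of cosets of [J], so membership in [P :/: J] can be tested
    on any representative ([hquot_imageP]). A product of classes is the image of the product of
    representatives, so the condition on [x *o y] lifts to [a *o b] lying in [P] and avoiding
    [I :*o: P], and the [I]-primality of [P] applies. *)

Lemma hyperideal0 (R : hyperringType) (J : hyperideal R) : (J : set R) 0.
Proof.
have [[a Ja] JB _] := hyperidealP J.
by rewrite -(subrr a); exact: JB.
Qed.

Lemma hyperidealD (R : hyperringType) (J : hyperideal R) a b :
  (J : set R) a -> (J : set R) b -> (J : set R) (a + b).
Proof.
have [_ JB _] := hyperidealP J => Ja Jb.
rewrite -[b]opprK -[- b]add0r; apply: (JB _ _ Ja).
by apply: (JB _ _ _ Jb); exact: hyperideal0.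
Qed.

(** If [a] has the class of some [p] in [P], then [a - p] is in [J], hence in [P], and so is
    [a = (a - p) + p]. *)
Lemma hquot_imageP (R : hyperringType) (P J : hyperideal R) (a : R) :
  J `<=` P -> (P :/: J) (hpi J a) <-> (P : set R) a.
Proof.
move=> JP; split=> [[p Pp /esym/hpiP/JP Pap]|Pa]; last by exists a.
by rewrite -(subrK p a); exact: hyperidealD.
Qed.

Lemma hquot_image_hyperideal (R : hyperringType) (P J : hyperideal R) :
  is_hyperideal (P :/: J).
Proof.
have [_ PB PM] := hyperidealP P; split.
- by exists (hpi J 0), 0 => //; exact: hyperideal0.
- move=> _ _ [a Pa <-] [b Pb <-].
  by rewrite -hpiN -hpiD; exists (a - b) => //; exact: PB.
- move=> r _ [a Pa <-]; have [s ->] := hpi_surj r.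
  rewrite [_ *o _]hquot_mulE => _ [c sac <-].
  by exists c => //; exact: PM sac.
Qed.

Theorem proposition2p9 (R : hyperringType) (I P J : hyperideal R)
    (hI : (I : set R) <> setT)
    (hP : I_prime I P)
    (hJP : J `<=` P) :
  [/\ is_hyperideal (P :/: J),
      P :/: J <> setT
    & forall x y : hquot J,
        x *o y `<=` (P :/: J) `\` (((I :*o: P) :+: J) :/: J) ->
        (P :/: J) x \/ (P :/: J) y].
Proof.
have [_ PT Pprime] := hP; split; first exact: hquot_image_hyperideal.
(* Properness: if [P :/: J] were everything, each [a] would have its class there, hence lie in
   [P]. *)
- move=> PJT; apply: PT; apply/seteqP; split=> // a _.
  by apply/(hquot_imageP _ _ _ _ hJP); rewrite PJT.
- move=> x y; have [a ->] := hpi_surj x; have [b ->] := hpi_surj y.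
  rewrite [_ *o _]hquot_mulE => ab_sub; rewrite !hquot_imageP//.
  apply: Pprime => c abc.
  have [/(hquot_imageP _ _ _ _ hJP) Pc cIP] :
      ((P :/: J) `\` (((I :*o: P) :+: J) :/: J)) (hpi J c).
    by apply: ab_sub; exists c.
  (* As [0] is in [J], [c = c + 0] puts an element of [I :*o: P] in [(I :*o: P) :+: J], so its class
     would be an excluded one. *)
  split=> // IPc; apply: cIP; exists c => //; exists c, 0.
  by split=> //; [exact: hyperideal0|rewrite addr0].
Qed.
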